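(* Consider the two-party problem $\mathrm{DISJ}_n^{k,k'}$ in which Alice gets $k$ strings $\mathbf{x}_1,\dots,\mathbf{x}_k\in\{0,1\}^n$, Bob gets $k'$ strings $\mathbf{y}_1,\dots,\mathbf{y}_{k'}\in\{0,1\}^n$, and they must determine whether there is a pair $(i,j)$ with $\mathbf{x}_i=\mathbf{y}_j$. If $k,k'=2^{o(n)}$, then the deterministic two-party communication complexity of $\mathrm{DISJ}_n^{k,k'}$ is $\Omega(\min\{k,k'\}\cdot n)$. *)

(* Defs.v *)
From mathcomp Require Import all_boot all_order all_algebra.
From mathcomp Require Import all_classical all_reals all_analysis.

Set Implicit Arguments.
Unset Strict Implicit.
Unset Printing Implicit Defensive.

(* Deterministic protocol trees (Yao; Kushilevitz-Nisan). At an internal node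
   the owner sends one bit depending only on their own input (the history is
   the position in the tree); leaves carry the output. *)
Inductive protocol (X Y Z : Type) : Type :=
| Output of Z
| AliceSends of (X -> bool) & protocol X Y Z & protocol X Y Z
| BobSends of (Y -> bool) & protocol X Y Z & protocol X Y Z.

Arguments Output {X Y Z}.
Arguments AliceSends {X Y Z}.
Arguments BobSends {X Y Z}.

Fixpoint run (X Y Z : Type) (p : protocol X Y Z) (x : X) (y : Y) : Z :=
  match p with
  | Output z => z
  | AliceSends a p0 p1 => if a x then run p1 x y else run p0 x y
  | BobSends b p0 p1 => if b y then run p1 x y else run p0 x y
  end.

Fixpoint cost (X Y Z : Type) (p : protocol X Y Z) : nat :=
  match p with
  | Output _ => 0
  | AliceSends _ p0 p1 => (maxn (cost p0) (cost p1)).+1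
  | BobSends _ p0 p1 => (maxn (cost p0) (cost p1)).+1
  end.

Definition computes (X Y Z : Type) (p : protocol X Y Z) (f : X -> Y -> Z) :=
  forall x y, run p x y = f x y.

Lemma computable_by_protocol (X Y : finType) (f : X -> Y -> bool) :
  exists p : protocol X Y bool, computes p f.
Proof.
have bob (g : Y -> bool) : exists p : protocol X Y bool,
    forall x y, run p x y = g y.
  by exists (BobSends g (Output false) (Output true)) => x y /=; case: (g y).
have alice (s : seq X) : exists p : protocol X Y bool,
    forall x y, x \in s -> run p x y = f x y.
  elim: s => [|x0 s [p hp]]; first by exists (Output false).
  have [q hq] := bob (f x0).
  exists (AliceSends (pred1 x0) p q) => x y; rewrite inE /=.
  by case: eqVneq => [->|_] //=; exact: hp.
have [p hp] := alice (enum X).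
by exists p => x y; apply: hp; rewrite mem_enum.
Qed.

Lemma protocol_cost_exists (X Y : finType) (f : X -> Y -> bool) :
  exists c, `[< exists2 p : protocol X Y bool, computes p f & cost p = c >].
Proof.
have [p hp] := computable_by_protocol f.
by exists (cost p); apply/asboolP; exists p.
Qed.

Definition det_cc (X Y : finType) (f : X -> Y -> bool) : nat :=
  ex_minn (protocol_cost_exists f).

Definition bitstring (n : nat) := n.-tuple bool.

(* Despite the name, the value is [true] iff the two families intersect. *)
Definition DISJ (n k k' : nat)
    (x : k.-tuple (bitstring n)) (y : k'.-tuple (bitstring n)) : bool :=
  [exists i : 'I_k, exists j : 'I_k', tnth x i == tnth y j].

Local Open Scope classical_set_scope.
Local Open Scope ring_scope.

(* [k = 2^{o(n)}] as an asymptotic upper bound. *)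
Definition two_pow_o (R : realType) (k : nat -> nat) : Prop :=
  exists g : nat -> R,
    g =o_\oo (fun n : nat => n%:R : R) /\ forall n, (k n)%:R <= 2 `^ g n.

(* Main.v *)
(** Write [m] for the smaller of the two family sizes, and cut part of the set
    of bit strings into [m] blocks of size [B]. If both players pick one string
    per block (the larger family repeats strings), the families are disjoint
    iff the picks differ in every block. The matrix of this subproblem is the
    [m]-th tensor power of [J - I], where [J] is the [B x B] all-ones matrix;
    since [J / (B - 1) - I] inverts [J - I], it has full rank [B ^ m]. The
    leaves of a protocol of cost [c] write the matrix as a sum of at most
    [2 ^ c] matrices of rank at most one, so [B ^ m <= 2 ^ c]. When
    [m = 2^{o(n)}] one can take [B >= 2 ^ (n / 2)]. *)
Require Import Defs.
From mathcomp Require Import all_boot all_order all_algebra.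
From mathcomp Require Import all_classical all_reals all_analysis.
From mathcomp Require Import zify.

Import Order.TTheory GRing.Theory Num.Theory.

Local Open Scope classical_set_scope.
Local Open Scope ring_scope.

(** Induction on the tree: 0/1 diagonal matrices split the rows at a node of Alice, or the columns
    at a node of Bob, according to the bit sent, and rank is subadditive. The maps [g] and [h]
    select a subproblem. *)
Lemma rank_run (F : fieldType) (X Y Z : Type) (v : Z -> F)
    (p : protocol X Y Z) (r s : nat) (g : 'I_r -> X) (h : 'I_s -> Y) :
  (\rank (\matrix_(i < r, j < s) v (run p (g i) (h j))) <= 2 ^ cost p)%N.
Proof.
have bound (p0 p1 : protocol X Y Z) :
    (2 ^ cost p1 + 2 ^ cost p0 <= 2 ^ (maxn (cost p0) (cost p1)).+1)%N.
  rewrite expnS mul2n -addnn addnC.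
  by rewrite leq_add// leq_exp2l// ?leq_maxl ?leq_maxr.
elim: p => [z|a p0 IH0 p1 IH1|b p0 IH0 p1 IH1] /=.
- have -> : \matrix_(i < r, j < s) v z =
      const_mx (v z) *m (const_mx 1 : 'rV[F]_s) :> 'M[F]_(r, s).
    by apply/matrixP => i j; rewrite !mxE big_ord1 !mxE mulr1.
  by rewrite expn0 (leq_trans (mxrankM_maxl _ _))// rank_leq_col.
- set M0 := (X in (\rank X <= 2 ^ cost p0)%N) in IH0.
  set M1 := (X in (\rank X <= 2 ^ cost p1)%N) in IH1.
  pose D1 := diag_mx (\row_i (a (g i))%:R) : 'M[F]_r.
  pose D0 := diag_mx (\row_i (~~ a (g i))%:R) : 'M[F]_r.
  rewrite (_ : \matrix_(i, j) _ = D1 *m M1 + D0 *m M0); last first.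
    apply/matrixP => i j; rewrite /D1 /D0 !mul_diag_mx !mxE.
    by case: (a _); rewrite !(mul1r, mul0r, addr0, add0r).
  apply: leq_trans (mxrank_add _ _) (leq_trans _ (bound p0 p1)).
  by apply: leq_add; apply: leq_trans (mxrankM_maxr _ _) _.
- set M0 := (X in (\rank X <= 2 ^ cost p0)%N) in IH0.
  set M1 := (X in (\rank X <= 2 ^ cost p1)%N) in IH1.
  pose D1 := diag_mx (\row_j (b (h j))%:R) : 'M[F]_s.
  pose D0 := diag_mx (\row_j (~~ b (h j))%:R) : 'M[F]_s.
  rewrite (_ : \matrix_(i, j) _ = M1 *m D1 + M0 *m D0); last first.
    apply/matrixP => i j; rewrite /D1 /D0 !mul_mx_diag !mxE.
    by case: (b _); rewrite !(mulr1, mulr0, addr0, add0r).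
  apply: leq_trans (mxrank_add _ _) (leq_trans _ (bound p0 p1)).
  by apply: leq_add; apply: leq_trans (mxrankM_maxl _ _) _.
Qed.

(** The one-block inverse, entry by entry: row [x] of the first factor has [#|J|.-1] ones, so the
    constant term contributes 1, and the other term subtracts [x != y]. *)
Lemma sum_neq_inverse (F : numFieldType) (J : finType) (x y : J) :
  (1 < #|J|)%N ->
  \sum_z (x != z)%:R * ((#|J|.-1)%:R^-1 - (z == y)%:R) = (x == y)%:R :> F.
Proof.
move=> J_gt1; have J1_neq0 : (#|J|.-1)%:R != 0 :> F.
  by rewrite pnatr_eq0; lia.
under eq_bigr do rewrite mulrBr.
rewrite sumrB -mulr_suml.
have -> : \sum_z (x != z)%:R = (#|J|.-1)%:R :> F.
  rewrite (bigD1 x)//= eqxx add0r -(cardC1 x) -sumr_const.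
  by apply: eq_big => z; rewrite ?inE 1?eq_sym// => ->.
rewrite (bigD1 y)//= big1 ?addr0 => [|z /negPf ->]; last by rewrite mulr0.
by rewrite eqxx mulr1 mulfV//; case: (x == y); rewrite /= ?subr0 ?subrr.
Qed.

Lemma natr_forall (F : comNzRingType) (I : finType) (P : pred I) :
  ([forall i, P i])%:R = \prod_i (P i)%:R :> F.
Proof.
have [/forallP allP|/forallPn[i /negPf nPi]] := boolP [forall i, P i].
  by rewrite big1// => i _; rewrite allP.
by rewrite (bigD1 i)//= nPi mul0r.
Qed.

Lemma rank_everywhere_neq (F : numFieldType) (I J : finType) :
  (1 < #|J|)%N ->
  \rank (\matrix_(a < #|{ffun I -> J}|, b < #|{ffun I -> J}|)
    ([forall i, (enum_val a : {ffun I -> J}) i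
                != (enum_val b : {ffun I -> J}) i])%:R : 'M[F]__) =
  #|{ffun I -> J}|.
Proof.
move=> J_gt1; set M := (X in \rank X).
pose N : 'M[F]_#|{ffun I -> J}| := \matrix_(a, b)
  \prod_i ((#|J|.-1)%:R^-1 - ((enum_val a : {ffun I -> J}) i
                              == (enum_val b : {ffun I -> J}) i)%:R).
apply: mxrank_unit; suff /mulmx1_unit[] : M *m N = 1%:M by [].
apply/matrixP => a b; rewrite !mxE.
under eq_bigr do rewrite !mxE natr_forall -big_split/=.
rewrite -(big_enum_val (fun z : {ffun I -> J} => \prod_i
  (((enum_val a : {ffun I -> J}) i != z i)%:R *
   ((#|J|.-1)%:R^-1 - (z i == (enum_val b : {ffun I -> J}) i)%:R)))).
(* A sum over functions of products over blocks becomes a product of sums, each an entry of the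
   one-block identity matrix. *)
rewrite -(bigA_distr_bigA (fun i z =>
  ((enum_val a : {ffun I -> J}) i != z)%:R *
  ((#|J|.-1)%:R^-1 - (z == (enum_val b : {ffun I -> J}) i)%:R))).
under eq_bigr do rewrite sum_neq_inverse//.
rewrite -natr_forall -(inj_eq enum_val_inj); congr (_%:R); congr nat_of_bool.
apply/forallP/eqP => [ab|-> //].
by apply/ffunP => i; exact/eqP.
Qed.

Lemma leq_cost_DISJ (n k k' B : nat)
    (p : protocol (k.-tuple (bitstring n)) (k'.-tuple (bitstring n)) bool) :
  computes p (@DISJ n k k') -> (1 < B)%N -> (minn k k' * B <= 2 ^ n)%N ->
  (B ^ minn k k' <= 2 ^ cost p)%N.
Proof.
move=> pE B_gt1; case mE : (minn k k') => [|m] mB.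
  by rewrite expn0 expn_gt0.
pose T := {ffun 'I_m.+1 -> 'I_B}.
have cardE : (#|{: 'I_m.+1 * 'I_B}| <= #|{: bitstring n}|)%N.
  by rewrite card_prod !card_ord card_tuple card_bool.
(* Encoding the block index together with the position keeps picks from different blocks
   distinct. *)
pose e (u : 'I_m.+1 * 'I_B) : bitstring n :=
  enum_val (widen_ord cardE (enum_rank u)).
have e_inj : injective e.
  by move=> u v /enum_val_inj[] /val_inj /enum_rank_inj.
(* [inord] sends the indices beyond [m] to block [0]: that string is repeated. *)
pose pick l (z : T) : l.-tuple (bitstring n) :=
  [tuple e (inord i, z (inord i)) | i < l].
have DISJ_pick z t :
    ~~ DISJ (pick k z) (pick k' t) = [forall i, z i != t i].
  rewrite -negb_exists; congr negb; apply/existsP/existsP => [[i]|[i zti]].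
    move=> /existsP[j]; rewrite !tnth_mktuple => /eqP/e_inj[ij zt].
    by exists (inord i); rewrite zt ij.
  have [ik ik'] : (i < k /\ i < k')%N by move: (ltn_ord i); lia.
  exists (Ordinal ik); apply/existsP; exists (Ordinal ik').
  by rewrite !tnth_mktuple /= inord_val (eqP zti).
(* The output is negated so that disjoint pairs give the entries 1. *)
have := rank_run rat _ _ _ (fun b => (~~ b)%:R) p _ _
  (fun a : 'I_#|T| => pick k (enum_val a))
  (fun b : 'I_#|T| => pick k' (enum_val b)).
under eq_mx do rewrite pE DISJ_pick.
by rewrite rank_everywhere_neq ?card_ffun !card_ord.
Qed.

Lemma leq_det_cc_DISJ (n k k' a : nat) :
  (minn k k' * 2 ^ a <= 2 ^ n)%N ->
  (minn k k' * a <= det_cc (@DISJ n k k'))%N.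
Proof.
rewrite /det_cc; case: ex_minnP => _ /asboolP[p pE <-] _.
(* Blocks of size [2 ^ 0] are too small for the rank bound, but then the claim is trivial. *)
case: a => [|a] mB; first by rewrite muln0.
rewrite -(@leq_exp2l 2)// mulnC expnM.
by apply: leq_cost_DISJ => //; rewrite (@leq_exp2l 2 1).
Qed.

Lemma two_pow_o_near (R : realType) (k : nat -> nat) :
  two_pow_o R k -> \forall n \near \oo, (k n <= 2 ^ n./2)%N.
Proof.
move=> [g [/eqoP go kg]].
(* The factor 1/4, rather than 1/2, absorbs the rounding in [n./2]. *)
have /go {}go : 0 < 4^-1 :> R by rewrite invr_gt0.
near=> n.
rewrite -(ler_nat R) (le_trans (kg n))// natrX -powR_mulrn//.
rewrite ler_powR ?ler1n// (le_trans (ler_norm _))//.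
have := near go n; rewrite /= normr_nat => /(_ _)/le_trans -> //.
have n2 : (n <= 4 * n./2)%N.
  have n_ge2 : (2 <= n)%N by near: n; exact: nbhs_infty_ge.
  by lia.
by rewrite ler_pdivrMl// -natrM ler_nat.
Unshelve. all: by end_near. Qed.

Theorem theoremA1 (R : realType) (k k' : nat -> nat)
    (hk : two_pow_o R k) (hk' : two_pow_o R k') :
  (fun n : nat => (det_cc (@DISJ n (k n) (k' n)))%:R : R)
    \is 'Omega_\oo (fun n : nat => (minn (k n) (k' n) * n)%N%:R : R).
Proof.
apply/asboolP; exists 2^-1; first by rewrite invr_gt0.
have := two_pow_o_near _ _ hk; apply: filterS => n kn.
rewrite !normr_nat ler_pdivrMl// -natrM ler_nat.
(* Blocks of size [2 ^ uphalf n] fit because [n./2 + uphalf n = n], and [n <= 2 * uphalf n] yields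
   the constant 1/2. *)
apply: (@leq_trans (2 * (minn (k n) (k' n) * uphalf n))%N).
  by rewrite mulnCA leq_mul2l; apply/orP; right; lia.
rewrite leq_mul2l /=; apply: leq_det_cc_DISJ.
apply: (@leq_trans (2 ^ n./2 * 2 ^ uphalf n)%N).
  by rewrite leq_mul2r (leq_trans (geq_minl _ _) kn) orbT.
by rewrite -expnD leq_exp2l//; lia.
Qed.
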